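(* For $\theta>0$, let $$\phi_\theta(x)=\psi(x)+\ln\bigl(e^{\theta/x}-1\bigr),\qquad x\in(0,\infty).$$ Then: (1) The function $\phi_\theta$ is strictly increasing on $(0,\infty)$ if and only if $0<\theta\le1$, and it is strictly decreasing on $(0,\infty)$ if $\theta\ge2$. (2) The function $\phi_\theta$ is strictly concave on $(0,\infty)$ if $0<\theta\le1$, and it is strictly convex on $(0,\infty)$ if $\theta\ge2$. (3) $\lim_{x\to\infty}\phi_\theta(x)=\ln\theta$ and $$\lim_{x\to0^+}\phi_\theta(x)=\begin{cases} -\gamma,&\theta=1,\\ \infty,&\theta>1,\\ -\infty,&0<\theta<1. \end{cases}$$
   Context: $\Gamma$ is Euler's gamma function, $\psi(x)=\Gamma'(x)/\Gamma(x)$ is the psi (digamma) function, and $\gamma=0.577\ldots$ is the Euler–Mascheroni constant. *)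

(* Defs.v *)
From HB Require Import structures.
From mathcomp Require Import all_boot all_order all_algebra.
From mathcomp Require Import all_classical all_reals all_analysis.

Set Implicit Arguments.
Unset Strict Implicit.
Unset Printing Implicit Defensive.

Import Order.TTheory GRing.Theory Num.Theory.
Import numFieldNormedType.Exports.

Local Open Scope classical_set_scope.
Local Open Scope ring_scope.

(* Euler's integral of the second kind. It converges for 0 < x, the only values
   of x that are used. *)
Definition Gamma (R : realType) (x : R) : R :=
  \int[lebesgue_measure]_(t in `]0, +oo[) (t `^ (x - 1) * expR (- t)).

Definition digamma (R : realType) (x : R) : R := derive1 (@Gamma R) x / Gamma x.

(* [series harmonic n] is 1 + 1/2 + ... + 1/n. *)
Definition euler_mascheroni (R : realType) : R :=
  limn (fun n : nat => series (@harmonic R) n - ln n%:R).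

Definition phi (R : realType) (theta x : R) : R :=
  digamma x + ln (expR (theta / x) - 1).

Definition strictly_increasing_on (R : realType) (D : set R) (f : R -> R) : Prop :=
  {in D &, {homo f : x y / x < y}}.

Definition strictly_decreasing_on (R : realType) (D : set R) (f : R -> R) : Prop :=
  {in D &, {homo f : x y /~ x < y}}.

Definition strictly_convex_on (R : realType) (D : set R) (f : R -> R) : Prop :=
  forall x y t : R, D x -> D y -> x != y -> 0 < t < 1 ->
    f (t * x + (1 - t) * y) < t * f x + (1 - t) * f y.

Definition strictly_concave_on (R : realType) (D : set R) (f : R -> R) : Prop :=
  forall x y t : R, D x -> D y -> x != y -> 0 < t < 1 ->
    t * f x + (1 - t) * f y < f (t * x + (1 - t) * y).

(* Main.v *)
Require Import Defs.
From HB Require Import structures.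
From mathcomp Require Import all_boot all_order all_algebra.
From mathcomp Require Import all_classical all_reals all_analysis.
From mathcomp Require Import measurable_realfun.
From mathcomp Require Import ring lra.

(** Everything about [phi theta] follows from its strict convexity or concavity
and its two limits. A strictly convex function with a finite limit at infinity is
strictly decreasing ([strictly_convex_decreasing]), so convexity, concavity and
the limit at infinity give the monotonicity claims; for [1 < theta] the limit
[+oo] at [0] prevents [phi theta] from increasing.

All that is needed about the digamma function is [psi (x + 1) = psi x + 1/x],
[ln x - 1/x <= psi x <= ln x] and its continuity and value at [1]. These come
from the Bohr-Mollerup argument: [ln Gamma] is convex and satisfies
[f (x + 1) = f x + ln x], and the slopes of any such [f] at a large point [z] are
squeezed between [ln (z - 2)] and [ln z]. Hence [f] is differentiable, and its
derivative is the limit of [ln (x + N) - \sum_(k < N) 1 / (x + k)]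
([is_derive_convex_solution]). In particular [Gamma] is never differentiated
under the integral sign.

Second derivatives of [psi] are avoided as well. If [F] has a limit at infinity
and [F x - F (x + 1)] is strictly convex, then so is [F], by telescoping
([strictly_convex_telescope]); for [F] equal to [psi] plus an elementary function
these differences are elementary. This yields that [psi y - ln (y - 1/2)] is
strictly convex and [psi y - ln y + 1/(2y) + 1/(24y^2)] strictly concave for
[1 < y]. Writing [psi x = psi (x + 1) - 1/x], the function [phi theta x] is one
of them at [x + 1] plus an elementary remainder, whose second derivative is
controlled as follows. With [w = theta / x] one has
[x^2 (ln (e^(theta/x) - 1))'' = expm1_curvature w], and completing squares and
factoring in the variable [e^w - 1] gives
[1 + w <= expm1_curvature w <= (1 + w/2)^2]. The lower bound settles
[2 <= theta], the upper one [theta <= 1], except for small [x], where the term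
[1/x] dominates. *)

Set Implicit Arguments.
Unset Strict Implicit.

Import Order.TTheory GRing.Theory Num.Theory.
Import numFieldNormedType.Exports.

Local Open Scope classical_set_scope.
Local Open Scope ring_scope.

(** * Derivative rules *)

(** The rules are stated for functions written pointwise, with the derivative in
product form, so that the derivative of a nested expression is assembled by
unification. *)
Section DerivativeRules.
Context {R : realType}.
Implicit Types (f g : R -> R) (x a b : R).

Lemma is_derive_add f g x a b : is_derive x 1 f a -> is_derive x 1 g b ->
  is_derive x 1 (fun t => f t + g t) (a + b).
Proof. by move=> df dg; exact: is_deriveD. Qed.

Lemma is_derive_opp f x a : is_derive x 1 f a ->
  is_derive x 1 (fun t => - f t) (- a).
Proof. by move=> df; exact: is_deriveN. Qed.

Lemma is_derive_mul f g x a b : is_derive x 1 f a -> is_derive x 1 g b ->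
  is_derive x 1 (fun t => f t * g t) (a * g x + f x * b).
Proof.
move=> df dg; have := @is_deriveM _ _ f g x 1 a b df dg.
move=> h; apply: is_derive_eq; rewrite /GRing.scale/=; ring.
Qed.

Lemma is_derive_inv f x a : f x != 0 -> is_derive x 1 f a ->
  is_derive x 1 (fun t => (f t)^-1) (- a / f x ^+ 2).
Proof.
move=> fx df; have h := @is_deriveV _ f x a 1 fx df.
by apply: is_derive_eq; rewrite /GRing.scale/= !mulNr mulrC.
Qed.

Lemma is_derive_exp f x a : is_derive x 1 f a ->
  is_derive x 1 (fun t => expR (f t)) (a * expR (f x)).
Proof.
move=> df; have h := @is_derive1_comp _ expR f x _ _ (is_derive_expR (f x)) df.
by apply: is_derive_eq; rewrite mulrC.
Qed.

Lemma is_derive_log f x a : 0 < f x -> is_derive x 1 f a ->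
  is_derive x 1 (fun t => ln (f t)) (a / f x).
Proof.
move=> fx df; have h := @is_derive1_comp _ (@ln R) f x _ _ (is_derive1_ln fx) df.
by apply: is_derive_eq; rewrite mulrC.
Qed.

Lemma is_derive_addc c x : is_derive x 1 (fun t : R => t + c) 1.
Proof. by apply: is_derive_eq; rewrite addr0. Qed.

End DerivativeRules.

(** * The Gamma integral *)

Section WeightedExponential.
Context {R : realType}.

(** Convexity of the exponential, normalized by [a] and [b] as in the proof of
Hoelder's inequality. *)
Lemma weighted_expR_le (a b p q l : R) : 0 < a -> 0 < b -> 0 <= l <= 1 ->
  let M := expR (l * ln a + (1 - l) * ln b) in
  expR (l * p + (1 - l) * q) <= l * M / a * expR p + (1 - l) * M / b * expR q.
Proof.
move=> a0 b0 /andP[l0 l1] /=; set m := l * ln a + (1 - l) * ln b.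
set C := l * p + (1 - l) * q.
pose dA := p - ln a - (C - m); pose dB := q - ln b - (C - m).
have -> : l * expR m / a * expR p = expR C * (l * expR dA).
  rewrite /dA !expRB (lnK (x := a)) ?posrE//; field.
  by rewrite !gt_eqF ?expR_gt0.
have -> : (1 - l) * expR m / b * expR q = expR C * ((1 - l) * expR dB).
  rewrite /dB !expRB (lnK (x := b)) ?posrE//; field.
  by rewrite !gt_eqF ?expR_gt0.
rewrite -mulrDr ler_peMr ?expR_ge0//.
(* The tangent at 0 suffices, because l * dA + (1 - l) * dB = 0. *)
apply: (@le_trans _ _ (l * (1 + dA) + (1 - l) * (1 + dB))).
  by rewrite /dA /dB /C /m le_eqVlt; apply/orP; left; apply/eqP; ring.
by rewrite lerD// ler_wpM2l ?expR_ge1Dx ?subr_ge0.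
Qed.

End WeightedExponential.

Section GammaIntegral.
Context {R : realType}.
Notation mu := (@lebesgue_measure R).
Implicit Types x t : R.

Let k x t : R := t `^ (x - 1) * expR (- t).
Let primitive x t : R := t `^ x * expR (- t).
Let seg (n : nat) : set R := `[n.+2%:R^-1, n.+2%:R].
Let pos : set R := `]0, +oo[.
(** The same integral with values in the extended reals: its finiteness is proved
only below, from the functional equation. *)
Let Gbar x : \bar R := (\int[mu]_(t in pos) (k x t)%:E)%E.
Let A x n : \bar R := (\int[mu]_(t in seg n) (k x t)%:E)%E.

Let k_ge0 x t : 0 <= k x t.
Proof. by rewrite /k mulr_ge0 ?powR_ge0 ?expR_ge0. Qed.

Let is_derive_primitive x t : 0 < t ->
  is_derive t 1 (primitive x) (x * k x t - k (x + 1) t).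
Proof.
move=> t0; rewrite /primitive.
apply: (is_derive_eq (is_derive_mul (is_derive1_powR x t0)
  (is_derive_exp (is_derive_opp (is_derive_id t 1))))).
by rewrite /k addrK; ring.
Qed.

Let continuous_k x t : 0 < t -> {for t, continuous (k x)}.
Proof.
move=> t0; apply/differentiable_continuous/derivable1_diffP.
by case: (is_derive_mul (is_derive1_powR (x - 1) t0)
  (is_derive_exp (is_derive_opp (is_derive_id t 1)))).
Qed.

Let seg_gt0 n t : t \in seg n -> 0 < t.
Proof.
by rewrite inE /seg/= in_itv/= => /andP[+ _]; apply: lt_le_trans; rewrite invr_gt0.
Qed.

Let seg_lt n : n.+2%:R^-1 < n.+2%:R :> R.
Proof.
rewrite (@lt_trans _ _ 1)// ?ltr1n// invf_lt1 ?ltr0n//.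
by rewrite ltr1n.
Qed.

Let within_continuous_k x n : {within seg n, continuous (k x)}.
Proof.
by apply: continuous_in_subspaceT => t /seg_gt0; exact: continuous_k.
Qed.

Let bigcup_seg : \bigcup_n seg n = pos.
Proof.
apply/seteqP; split => t /=.
  by move=> [n _ nt]; rewrite /pos/= in_itv/= andbT; apply/(@seg_gt0 n); rewrite inE.
rewrite /pos/= in_itv/= andbT => t0.
pose m := Num.trunc (t + t^-1); exists m => //=; rewrite /seg/= in_itv/=.
have tv : t + t^-1 < m.+2%:R.
  apply: (@lt_trans _ _ m.+1%:R); last by rewrite ltr_nat.
  by rewrite truncnS_gt.
have v0 : 0 < t^-1 by rewrite invr_gt0.
apply/andP; split; last by apply/ltW/(le_lt_trans _ tv); rewrite lerDl ltW.
rewrite -[leRHS]invrK lef_pV2 ?posrE//.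
by apply/ltW/(le_lt_trans _ tv); rewrite lerDr ltW.
Qed.

Let nondecreasing_seg : nondecreasing_seq seg.
Proof.
apply/nondecreasing_seqP => n; rewrite subsetEset => t /=.
rewrite /seg/= !in_itv/= => /andP[a b]; apply/andP; split.
  by apply: le_trans a; rewrite lef_pV2 ?posrE// ler_nat.
by apply: (le_trans b); rewrite ler_nat.
Qed.

Let measurable_k x (D : set R) : measurable D -> D `<=` pos ->
  measurable_fun D (k x).
Proof.
have mpos : measurable pos by exact: measurable_itv.
move=> mD D0.
apply: (@measurable_funS _ _ _ _ pos) => //.
apply: open_continuous_measurable_fun => // t.
by rewrite inE /pos/= in_itv/= andbT; exact: continuous_k.
Qed.

Let seg_sub n : seg n `<=` pos.
Proof. by rewrite -bigcup_seg; exact: bigcup_sup. Qed.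

Let A_cvg x : A x n @[n --> \oo] --> Gbar x.
Proof.
rewrite /Gbar -bigcup_seg; apply: ge0_nondecreasing_set_cvg_integral => //.
- by move=> i; exact: measurable_itv.
- move=> i; apply/measurable_EFinP; apply: measurable_k; last exact: seg_sub.
  exact: measurable_itv.
- by move=> i t _; rewrite lee_fin.
Qed.

Let integrable_seg x n : mu.-integrable (seg n) (EFin \o k x).
Proof.
apply: continuous_compact_integrable; first exact: segment_compact.
exact: within_continuous_k.
Qed.

Let A_fin x n : A x n = (fine (A x n))%:E.
Proof.
rewrite fineK//; apply: (integrable_fin_num _ (integrable_seg x n)).
exact: measurable_itv.
Qed.

(** Integration by parts on a compact segment, where no singularity occurs. *)
Let A_rec x n : x * fine (A x n) =
  fine (A (x + 1) n) + (primitive x n.+2%:R - primitive x n.+2%:R^-1).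
Proof.
have ctsF t : 0 < t -> {for t, continuous (primitive x)}.
  move=> t0; apply/differentiable_continuous/derivable1_diffP.
  by case: (is_derive_primitive x t0).
have n0 : 0 < n.+2%:R^-1 :> R by rewrite invr_gt0.
have H : (\int[mu]_(t in seg n) (x * k x t - k (x + 1) t)%:E =
    (primitive x n.+2%:R)%:E - (primitive x n.+2%:R^-1)%:E)%E.
  apply: continuous_FTC2 => //.
  - apply: continuous_in_subspaceT => t /seg_gt0 t0.
    apply: cvgB; last exact: continuous_k.
    by apply: cvgMr; exact: continuous_k.
  - split.
    + move=> t; rewrite in_itv/= => /andP[/(lt_trans n0) t0 _].
      by case: (is_derive_primitive x t0).
    + by apply/cvg_at_right_filter/ctsF.
    + by apply/cvg_at_left_filter/ctsF.
  - move=> t; rewrite in_itv/= => /andP[/(lt_trans n0) t0 _].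
    by rewrite derive1E; case: (is_derive_primitive x t0).
have mS : measurable (seg n : set (measurableTypeR R)) by exact: measurable_itv.
have I1 : mu.-integrable (seg n) (fun t => x%:E * (k x t)%:E)%E.
  by apply: integrableZl => //; exact: integrable_seg.
have E : (primitive x n.+2%:R - primitive x n.+2%:R^-1)%:E =
    (x * fine (A x n) - fine (A (x + 1) n))%:E.
  rewrite EFinB -H EFinB EFinM -!A_fin.
  under eq_integral do rewrite EFinB.
  rewrite integralB_EFin//.
  by under eq_integral do rewrite EFinM; rewrite integralZl//; exact: integrable_seg.
by case: E => ->; rewrite subrKC.
Qed.


Let primitive_cvg0 x : 0 < x -> primitive x n.+2%:R^-1 @[n --> \oo] --> (0 : R).
Proof.
move=> x0; have h := (cvg_at_rightP _ _ _).1 (powR_cvg0 x0).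
apply: (@squeeze_cvgr _ _ _ _ (fun=> 0) (fun n : nat => n.+2%:R^-1 `^ x)).
- near=> n; rewrite /primitive mulr_ge0 ?powR_ge0 ?expR_ge0//=.
  by rewrite ler_piMr ?powR_ge0// expR_le1 oppr_le0 invr_ge0.
- exact: cvg_cst.
- apply: (h (fun n : nat => n.+2%:R^-1)); split; first by move=> n; rewrite invr_gt0.
  apply/gtr0_cvgV0; first by near=> n.
  apply/cvgryPge => M; near=> n; apply: (@le_trans _ _ n%:R); last by rewrite ler_nat -addn2 leq_addr.
  by near: n; exact: nbhs_infty_ger.
Unshelve. all: by end_near. Qed.

(** From [s <= expR s] at [s = t / (2 * x)] one gets
[t `^ x <= (2 * x) `^ x * expR (t / 2)]. *)
Let primitive_cvgy x : 0 < x -> primitive x n.+2%:R @[n --> \oo] --> (0 : R).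
Proof.
move=> x0; have x20 : 0 < 2 * x by rewrite mulr_gt0.
have x_ge0 := ltW x0.
apply: (@squeeze_cvgr _ _ _ _ (fun=> 0)
  (fun n : nat => (2 * x) `^ x * expR (- (n.+2%:R / 2)))).
- near=> n; rewrite /primitive mulr_ge0 ?powR_ge0 ?expR_ge0//=.
  have -> : expR (- (n.+2%:R / 2)) =
      expR (n.+2%:R / (2 * x)) `^ x * expR (- n.+2%:R) :> R.
    rewrite -expRM -expRD; congr expR; field; exact: lt0r_neq0.
  rewrite mulrA -powRM ?expR_ge0 ?mulr_ge0//.
  rewrite ler_pM2r ?expR_gt0// ge0_ler_powR ?nnegrE ?mulr_ge0 ?expR_ge0//.
  rewrite -ler_pdivrMl// mulrC; apply: le_trans (expR_ge1Dx _).
  by rewrite lerDr.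
- exact: cvg_cst.
- rewrite -[X in _ --> X](mulr0 ((2 * x) `^ x)).
  apply: cvgMr.
  apply: (@cvg_comp _ _ _ (fun n : nat => n.+2%:R / 2 : R) (fun t => expR (- t))
    _ (pinfty_nbhs R)); last exact: cvgr_expR.
  apply/cvgryPge => M; near=> n; rewrite ler_pdivlMr//.
  apply: (@le_trans _ _ n%:R); last by rewrite ler_nat -addn2 leq_addr.
  by near: n; exact: nbhs_infty_ger.
Unshelve. all: by end_near. Qed.

Let boundary_cvg0 x : 0 < x ->
  (primitive x n.+2%:R - primitive x n.+2%:R^-1) @[n --> \oo] --> (0 : R).
Proof.
move=> x0; rewrite -[X in _ --> X](subr0 0).
by apply: cvgB; [exact: primitive_cvgy|exact: primitive_cvg0].
Qed.

(** Letting the segments grow, finiteness passes from [x] to [x + 1] and back, so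
the integrals with [x < 1], singular at [0], need no separate estimate. *)
Let Gbar_up x g : 0 < x -> Gbar x = g%:E -> Gbar (x + 1) = (x * g)%:E.
Proof.
move=> x0 xg; have := @A_cvg x; rewrite xg => /fine_cvg Ag.
apply: (cvg_unique _ (@A_cvg (x + 1))) => //.
rewrite (_ : A (x + 1) = EFin \o (fun n => x * fine (A x n) -
    (primitive x n.+2%:R - primitive x n.+2%:R^-1))); last first.
  by apply/funext => n /=; rewrite A_rec addrK -A_fin.
apply: cvg_EFin; first by near=> n.
rewrite -[X in _ --> X]subr0; apply: cvgB; last exact: boundary_cvg0.
by apply: cvgMr.
Unshelve. all: by end_near. Qed.

Let Gbar_down x g : 0 < x -> Gbar (x + 1) = g%:E -> Gbar x = (g / x)%:E.
Proof.
move=> x0 xg; have := @A_cvg (x + 1); rewrite xg => /fine_cvg Ag.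
apply: (cvg_unique _ (@A_cvg x)) => //.
rewrite (_ : A x = EFin \o (fun n => (fine (A (x + 1) n) +
    (primitive x n.+2%:R - primitive x n.+2%:R^-1)) / x)); last first.
  by apply/funext => n /=; rewrite -A_rec mulrC mulKf ?gt_eqF// -A_fin.
apply: cvg_EFin; first by near=> n.
apply: cvgMl; rewrite -[X in _ --> X]addr0; apply: cvgD; last exact: boundary_cvg0.
exact: Ag.
Unshelve. all: by end_near. Qed.

Let Gbar_le x y z (c d : R) : 0 <= c -> 0 <= d ->
  (forall t, 0 < t -> k z t <= c * k x t + d * k y t) ->
  (Gbar z <= c%:E * Gbar x + d%:E * Gbar y)%E.
Proof.
move=> c0 d0 zxy.
have mpos : measurable (pos : set (measurableTypeR R)) by exact: measurable_itv.
have mk w : measurable_fun (pos : set (measurableTypeR R)) (EFin \o k w).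
  by apply/measurable_EFinP; exact: measurable_k.
rewrite -!ge0_integralZl_EFin//.
- rewrite -ge0_integralD//.
  + apply: ge0_le_integral => //.
    * by move=> t _; rewrite lee_fin.
    * exact: mk.
    * by apply: emeasurable_funD; apply: measurable_funeM; exact: mk.
    * by move=> t; rewrite /pos/= in_itv/= andbT => /zxy; rewrite -!EFinM -EFinD lee_fin.
  + by move=> t _; rewrite -EFinM lee_fin mulr_ge0.
  + apply: measurable_funeM; exact: mk.
  + by move=> t _; rewrite -EFinM lee_fin mulr_ge0.
  + apply: measurable_funeM; exact: mk.
- by move=> t _; rewrite lee_fin.
- exact: mk.
- by move=> t _; rewrite lee_fin.
- exact: mk.
Qed.

Let Gbar1 : Gbar 1 = 1%E.
Proof.
have cF t : {for t, continuous (fun t : R => expR (- t))}.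
  by apply: continuous_comp; [exact: opp_continuous|exact: continuous_expR].
have dF t : is_derive t 1 (fun t : R => - expR (- t)) (expR (- t)).
  apply: (is_derive_eq (is_derive_opp (is_derive_exp (is_derive_opp (is_derive_id t 1))))).
  by rewrite mulN1r opprK.
transitivity (\int[mu]_(t in `[0%R, +oo[) (expR (- t))%:E)%E.
  rewrite -integral_itv_obnd_cbnd.
    by apply: eq_integral => t _; rewrite /k subrr powRr0 mul1r.
  apply/measurable_EFinP; apply: measurable_funTS.
  by apply: continuous_measurable_fun => t; exact: cF.
rewrite (@ge0_continuous_FTC2y _ _ (fun t : R => - expR (- t)) _ 0).
- by rewrite oppr0 expR0 EFinN oppeK add0e.
- by move=> t _; exact: expR_ge0.
- by apply: continuous_subspaceT => t; exact: cF.
- by rewrite -oppr0; apply: cvgN; exact: cvgr_expR.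
- by move=> t _; case: (dF t).
- by apply/cvg_at_right_filter; apply: cvgN; exact: cF.
- by move=> t _; rewrite derive1E; case: (dF t).
Qed.

Let Gbar_nat n : Gbar n.+1%:R = (n`!%:R)%:E.
Proof.
elim: n => [|n IH]; first by rewrite Gbar1.
by rewrite -natr1 (Gbar_up _ IH) ?ltr0n// factS natrM.
Qed.

Let Gbar_ge0 x : (0 <= Gbar x)%E.
Proof. by apply: integral_ge0 => t _; rewrite lee_fin. Qed.

(** For [1 <= x] the integrand is dominated by those at [1] and at a larger
integer, where the integral is a factorial. *)
Let Gbar_ge1_fin x : 1 <= x -> Gbar x \is a fin_num.
Proof.
move=> x1; rewrite ge0_fin_numE//.
have := @Gbar_le 1 (Num.trunc x).+1%:R x 1 1 ler01 ler01.
rewrite !mul1e Gbar1 Gbar_nat => /(_ _)/le_lt_trans; apply; last by rewrite ltry.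
move=> t t0; rewrite !mul1r /k -mulrDl ler_pM2r ?expR_gt0//.
have [t1|/ltW t1] := leP t 1.
  apply: (@le_trans _ _ (t `^ (1 - 1))); last by rewrite lerDl powR_ge0.
  by rewrite ger_powR ?t0// lerB.
apply: (@le_trans _ _ (t `^ ((Num.trunc x).+1%:R - 1))).
  by rewrite ler_powR// lerB// ltW// truncnS_gt.
by rewrite lerDr powR_ge0.
Qed.

Let Gbar_fin x : 0 < x -> Gbar x = (Gamma x)%:E.
Proof.
move=> x0; have : Gbar x \is a fin_num.
  have /Gbar_ge1_fin : 1 <= x + 1 by rewrite lerDr ltW.
  by case: (Gbar (x + 1)) (@Gbar_down x) => //= r /(_ r x0 erefl) ->.
by move=> /fineK <-.
Qed.

Lemma GammaS x : 0 < x -> Gamma (x + 1) = x * Gamma x.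
Proof.
move=> x0; apply: EFin_inj; rewrite -Gbar_fin ?addr_gt0//.
by apply: Gbar_up => //; exact: Gbar_fin.
Qed.

(** The integrand is at least [expR (- 2) / 2] on [[1, 2]]. *)
Lemma Gamma_gt0 x : 0 < x -> 0 < Gamma x.
Proof.
move=> x0; rewrite -lte_fin -Gbar_fin//.
pose c : R := expR (- 2) / 2.
have c0 : 0 < c by rewrite divr_gt0 ?expR_gt0.
have mI : measurable (`[1, 2] : set (measurableTypeR R)) by exact: measurable_itv.
have I0 : `[1, 2] `<=` pos.
  by move=> t/=; rewrite /pos/= !in_itv/= andbT => /andP[+ _]; exact: lt_le_trans.
have mk : measurable_fun (`[1, 2] : set (measurableTypeR R)) (EFin \o k x).
  by apply/measurable_EFinP; exact: measurable_k.
apply: (@lt_le_trans _ _ (\int[mu]_(t in `[1%R, 2%R]) c%:E)%E).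
  rewrite integral_cst// [X in (_ * X)%E](_ : _ = 1%E) ?mule1 ?lte_fin//.
  rewrite [LHS](@lebesgue_measure_itv R `[1, 2]) /= lte_fin ltr1n -EFinB.
  by congr EFin; ring.
apply: (@le_trans _ _ (\int[mu]_(t in `[1%R, 2%R]) (k x t)%:E)%E).
  apply: ge0_le_integral => //; first by move=> t _; rewrite lee_fin ltW.
  move=> t /=; rewrite in_itv/= lee_fin => /andP[t1 t2].
  rewrite /k /c mulrC ler_pM ?invr_ge0 ?expR_ge0//.
    apply: (@le_trans _ _ t^-1).
      by rewrite lef_pV2 ?posrE// (lt_le_trans _ t1).
    rewrite -powR_inv1 ?(le_trans _ t1)// ler_powR//.
    by rewrite -[leLHS]add0r lerD2r ltW.
  by rewrite ler_expR lerN2.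
apply: ge0_subset_integral => //.
- exact: measurable_itv.
- by apply/measurable_EFinP; apply: measurable_k => //; exact: measurable_itv.
- by move=> t _; rewrite lee_fin.
Qed.

(** Hoelder's inequality: integrate [weighted_expR_le] with [a] and [b] equal to
[Gamma x] and [Gamma y]. *)
Lemma ln_Gamma_convex x y (l : R) : 0 < x -> 0 < y -> 0 <= l <= 1 ->
  ln (Gamma (l * x + (1 - l) * y)) <= l * ln (Gamma x) + (1 - l) * ln (Gamma y).
Proof.
move=> x0 y0 /andP[l0 l1].
have z0 : 0 < l * x + (1 - l) * y.
  have [->|l_neq1] := eqVneq l 1; first by rewrite subrr mul0r addr0 mul1r.
  apply: ltr_wpDl; first by rewrite mulr_ge0// ltW.
  by rewrite mulr_gt0// subr_gt0 lt_neqAle l_neq1.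
set z := _ + _; set M := _ + _.
have [[ax ay] az] := (Gamma_gt0 x0, Gamma_gt0 y0, Gamma_gt0 z0).
rewrite -(expRK M) ler_ln ?posrE ?expR_gt0// -lee_fin -Gbar_fin//.
have kE w t : 0 < t -> k w t = expR ((w - 1) * ln t - t).
  by move=> t0; rewrite /k /powR gt_eqF// expRD.
have wE (a b E : R) : 0 < a -> 0 < b -> l * E / a * a + (1 - l) * E / b * b = E.
  by move=> a0 b0; rewrite !mulfVK ?gt_eqF// -mulrDl subrKC mul1r.
have -> : (expR M)%:E = ((l * expR M / Gamma x)%:E * Gbar x +
    ((1 - l) * expR M / Gamma y)%:E * Gbar y)%E.
  by rewrite !Gbar_fin// -!EFinM -EFinD wE.
have M0 := expR_ge0 M.
apply: Gbar_le => [||t t0].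
- exact: divr_ge0 (mulr_ge0 l0 M0) (ltW ax).
- by apply: divr_ge0 (ltW ay); rewrite mulr_ge0 ?subr_ge0.
rewrite !kE// /M.
have -> : (z - 1) * ln t - t =
    l * ((x - 1) * ln t - t) + (1 - l) * ((y - 1) * ln t - t) by rewrite /z; ring.
by apply: weighted_expR_le => //; rewrite l0.
Qed.

End GammaIntegral.

(** * The digamma function as a limit *)

Section DifferenceQuotient.
Context {R : realType}.

Lemma is_derive_quotient (f : R -> R) (x a : R) :
  is_derive x 1 f a <-> h^-1 * (f (h + x) - f x) @[h --> 0^'] --> a.
Proof.
have E : (fun h => h^-1 * (f (h + x) - f x)) =
    (fun h => h^-1 *: ((f \o shift x) (h *: (1 : R)) - f x)).
  by apply/funext => h /=; rewrite /GRing.scale/= mulr1.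
split=> [[df <-]|fa].
- by move: df => /cvg_ex[l] fl; rewrite E /derive (cvg_lim _ fl).
- by split; [apply/cvg_ex; exists a; rewrite -E|rewrite /derive -E; exact: cvg_lim].
Qed.

End DifferenceQuotient.

Section GaussLimit.
Context {R : realType}.
Implicit Types x : R.

(** The logarithmic derivative of Gauss's product
[n^x n! / (x (x + 1) ... (x + n))], up to a term that tends to zero. *)
Definition gauss_approx (N : nat) x : R :=
  ln (x + N%:R) - \sum_(0 <= k < N) (x + k%:R)^-1.

Definition gauss_limit x : R := limn (gauss_approx ^~ x).

Let S (N : nat) x : R := \sum_(0 <= k < N) (x + k%:R)^-1.
Local Notation u := gauss_approx.
Local Notation P := gauss_limit.

Lemma addn_gt0 x (N : nat) : 0 < x -> 0 < x + N%:R.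
Proof. by move=> x0; rewrite ltr_wpDr. Qed.

Lemma ln_step x : 0 < x -> (x + 1)^-1 <= ln (x + 1) - ln x <= x^-1.
Proof.
move=> x0; have x10 : 0 < x + 1 by rewrite addr_gt0.
apply/andP; split.
- rewrite -lerN2 opprB -ln_div ?posrE//.
  have -> : x / (x + 1) = 1 + - (x + 1)^-1 by field; rewrite gt_eqF.
  by apply: le_ln1Dx; rewrite ltrN2 invf_lt1// ltrDr.
- rewrite -ln_div ?posrE//.
  have -> : (x + 1) / x = 1 + x^-1 by field; rewrite gt_eqF.
  by apply: le_ln1Dx; rewrite (lt_trans (ltrN10 _))// invr_gt0.
Qed.

Let u_noninc x : 0 < x -> nonincreasing_seq (u ^~ x).
Proof.
move=> x0; apply/nonincreasing_seqP => n.
rewrite /u -/(S _ _) /S big_nat_recr//= -natr1 addrA.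
by have /andP[_] := ln_step (addn_gt0 n x0); lra.
Qed.

(** Each term [1 / (x + k)] with [0 < k] is at most [ln (x + k) - ln (x + k - 1)],
so the sum is bounded by a telescoping one. *)
Let u_ge x N : 0 < x -> ln x - x^-1 <= u N x.
Proof.
move=> x0; apply: le_trans (u_noninc x0 (leqnSn N)).
have SN : S N.+1 x <= x^-1 + ln (x + N%:R) - ln x.
  elim: N => [|N IH]; first by rewrite /S big_nat1 !addr0 addrK.
  rewrite /S (big_nat_recr N.+1)//= -/(S N.+1 x) -[in leRHS]natr1.
  have /andP[+ _] := ln_step (addn_gt0 N x0); rewrite -addrA natr1.
  by lra.
have : ln (x + N%:R) <= ln (x + N.+1%:R).
  by rewrite ler_ln ?posrE ?addn_gt0// lerD2l ler_nat.
by rewrite /u -/(S _ _); lra.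
Qed.

Lemma gauss_approx_cvg x : 0 < x -> u n x @[n --> \oo] --> P x.
Proof.
move=> x0; apply: nonincreasing_is_cvgn; first exact: u_noninc.
by exists (ln x - x^-1) => _ [n _ <-]; exact: u_ge.
Qed.

Lemma gauss_limit_le x : 0 < x -> P x <= ln x.
Proof.
move=> x0; have := nonincreasing_cvgn_ge (u_noninc x0) (gauss_approx_cvg x0) 0.
by rewrite /u big_nil subr0 addr0.
Qed.

Lemma gauss_limit_ge x : 0 < x -> ln x - x^-1 <= P x.
Proof.
move=> x0; apply: limr_ge; first exact: gauss_approx_cvg.
by apply: nearW => n; exact: u_ge.
Qed.

Lemma gauss_limitS x : 0 < x -> P (x + 1) = P x + x^-1.
Proof.
move=> x0; have x10 : 0 < x + 1 by rewrite addr_gt0.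
apply: (cvg_unique _ (@gauss_approx_cvg (x + 1) x10)) => //.
rewrite (_ : u ^~ (x + 1) = fun n => u n.+1 x + x^-1).
  apply: cvgD; last exact: cvg_cst.
  by rewrite (cvg_shiftS (u ^~ x)); exact: gauss_approx_cvg.
apply/funext => n; rewrite /u big_nat_recl//= addr0 -natr1 (addrC n%:R) addrA.
under [in RHS]eq_bigr do rewrite -natr1 (addrC _ 1) addrA.
by lra.
Qed.

(** The error at [x] is the error in the asymptotics [P z ~ ln z] at the shifted
point, which makes the convergence uniform. *)
Lemma gauss_approxB x N : 0 < x -> u N x - P x = ln (x + N%:R) - P (x + N%:R).
Proof.
move=> x0; rewrite /u.
suff -> : P (x + N%:R) = P x + S N x by rewrite /S; lra.
elim: N => [|N IH]; first by rewrite /S big_nil !addr0.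
by rewrite -natr1 addrA gauss_limitS ?addn_gt0// IH /S big_nat_recr//= addrA.
Qed.

Lemma gauss_approx_dist x N : 0 < x -> (0 < N)%N -> `|u N x - P x| <= N%:R^-1.
Proof.
move=> x0 N0; have xN := addn_gt0 N x0.
rewrite gauss_approxB// ger0_norm ?subr_ge0 ?gauss_limit_le//.
apply: (@le_trans _ _ (x + N%:R)^-1).
  by have := gauss_limit_ge xN; lra.
by rewrite lef_pV2 ?posrE ?ltr0n// lerDr ltW.
Qed.

Lemma continuous_gauss_limit x : 0 < x -> {for x, continuous P}.
Proof.
move=> x0; have cu N : {for x, continuous (u N)}.
  have cD (k : nat) : y + k%:R @[y --> x] --> x + k%:R.
    by apply: cvgD; [exact: cvg_id|exact: cvg_cst].
  apply: cvgB.
    by apply: continuous_cvg (cD N); apply: continuous_ln; exact: addn_gt0.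
  elim: N => [|N IH].
    by rewrite big_nil; under eq_fun do rewrite big_nil; exact: cvg_cst.
  rewrite big_nat_recr//=; under eq_fun do rewrite big_nat_recr//=.
  apply: cvgD => //; apply: cvgV; last exact: cD.
  by rewrite gt_eqF// addn_gt0.
apply/cvgrPdist_le => e e0.
have e30 : 0 < e / 3 by rewrite divr_gt0.
pose N := (Num.trunc (e / 3)^-1).+1.
have N3 : N%:R^-1 <= e / 3.
  rewrite -[leRHS]invrK lef_pV2 ?posrE ?invr_gt0// ?ltr0n// ltW//.
  by rewrite truncnS_gt.
have /cvgrPdist_le /(_ _ e30) uN := cu N.
near=> y.
have y0 : 0 < y by near: y; exact: lt_nbhsr.
have h1 := @gauss_approx_dist x N x0 isT.
have h2 := @gauss_approx_dist y N y0 isT.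
have h3 : `|u N x - u N y| <= e / 3 by near: y; exact: uN.
move: h1 h2 h3; rewrite !ler_norml => /andP[? ?] /andP[? ?] /andP[? ?].
by apply/andP; split; lra.
Unshelve. all: by end_near. Qed.

Lemma gauss_limit1 : P 1 = - euler_mascheroni R.
Proof.
apply/eqP; rewrite -eqr_oppLR; apply/eqP/esym/cvg_lim => //.
rewrite (_ : (fun n => _) = fun n : nat => - u n 1 + (ln (n%:R + 1) - ln n%:R)); last first.
  apply/funext => n; rewrite /u /series/= opprB (addrC 1).
  under eq_bigr do rewrite -natr1 addrC.
  by lra.
rewrite -[X in _ --> X]addr0; apply: cvgD.
  by apply: cvgN; exact: gauss_approx_cvg.
apply: (@squeeze_cvgr _ _ _ _ (fun=> 0) (fun n : nat => n%:R^-1)).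
- near=> n; have n0 : 0 < n%:R :> R by rewrite ltr0n; near: n; exact: nbhs_infty_gt.
  by have /andP[h ->] := ln_step n0; rewrite andbT (le_trans _ h)// invr_ge0.
- exact: cvg_cst.
- apply/gtr0_cvgV0; last exact: cvgr_idn.
  by near=> n; rewrite ltr0n; near: n; exact: nbhs_infty_gt.
Unshelve. all: by end_near. Qed.

End GaussLimit.

(** Differentiability of the convex solutions of [f (x + 1) = f x + ln x], after
Bohr and Mollerup. *)
Section ConvexSolution.
Context {R : realType}.
Implicit Types x z h : R.

Variable f : R -> R.
Hypothesis f_step : forall x, 0 < x -> f (x + 1) = f x + ln x.
Hypothesis f_convex : forall x y l, 0 < x -> 0 < y -> 0 <= l <= 1 ->
  f (l * x + (1 - l) * y) <= l * f x + (1 - l) * f y.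

Let f_chord (a b c : R) : 0 < a -> a < b -> b < c ->
  (f b - f a) * (c - b) <= (f c - f b) * (b - a).
Proof.
move=> a0 ab bc; have ca : 0 < c - a by rewrite subr_gt0 (lt_trans ab).
have c0 : 0 < c by rewrite (lt_trans a0)// (lt_trans ab).
have l01 : 0 <= (c - b) / (c - a) <= 1.
  apply/andP; split; first by rewrite divr_ge0 ?ltW// subr_gt0.
  by rewrite ler_pdivrMr// mul1r lerD2l lerN2 ltW.
have := f_convex a0 c0 l01.
have -> : (c - b) / (c - a) * a + (1 - (c - b) / (c - a)) * c = b.
  by field; rewrite gt_eqF.
rewrite -(ler_pM2r ca).
have -> : ((c - b) / (c - a) * f a + (1 - (c - b) / (c - a)) * f c) * (c - a) =
    (c - b) * f a + (b - a) * f c by field; rewrite gt_eqF.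
by lra.
Qed.

Let f_slope_ge z h : 1 < z -> 0 < h -> h * ln (z - 1) <= f (z + h) - f z.
Proof.
move=> z1 h0; have z10 : 0 < z - 1 by rewrite subr_gt0.
have := @f_chord (z - 1) z (z + h) z10.
have := f_step z10; rewrite subrK => ->.
rewrite ltrBlDr ltrDl ltr01 ltrDl => /(_ isT h0).
by rewrite [X in _ * X <= _ -> _]addrAC subrr add0r opprB
  [X in _ <= _ * X -> _]addrC subrK; lra.
Qed.

Let f_slope_le z h : 0 < z -> 0 < h <= 1 -> f (z + h) - f z <= h * ln z.
Proof.
move=> z0 /andP[h0]; rewrite le_eqVlt => /orP[/eqP ->|h1].
  by rewrite f_step// mul1r addrAC subrr add0r.
have := @f_chord z (z + h) (z + 1) z0; rewrite ltrDl ltrD2l f_step// => /(_ h0 h1).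
by lra.
Qed.

(** Convexity compares a slope at [z] with the unit increments of [f] next to it,
which the functional equation makes logarithms. The bound [ln (z - 2)] is crude but
covers both signs of [h]. *)
Let f_slope z h : 2 < z -> 0 < `|h| <= 1 ->
  `|h * ln z - (f (z + h) - f z)| <= `|h| * (ln z - ln (z - 2)).
Proof.
move=> z2 h01; have z0 : 0 < z by rewrite (lt_trans _ z2).
have mono : ln (z - 2) <= ln (z - 1) <= ln z.
  by rewrite !ler_ln ?posrE; [|lra..]; apply/andP; split; lra.
have [h0|h0|h0] := ltgtP h 0.
- rewrite (ltr0_norm h0) in h01 *.
  have lo := @f_slope_ge (z + h) (- h).
  have hi := @f_slope_le (z + h) (- h).
  rewrite addrK in lo hi.
  have m1 : ln (z - 2) <= ln (z + h - 1) by rewrite ler_ln ?posrE; lra.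
  have m2 : ln (z + h) <= ln z by rewrite ler_ln ?posrE; lra.
  have {}lo : - h * ln (z + h - 1) <= f z - f (z + h) by apply: lo; lra.
  have {}hi : f z - f (z + h) <= - h * ln (z + h) by apply: hi; lra.
  have k1 : - h * ln (z - 2) <= - h * ln (z + h - 1) by rewrite ler_pM2l ?oppr_gt0.
  have k2 : - h * ln (z + h) <= - h * ln z by rewrite ler_pM2l ?oppr_gt0.
  rewrite ler_norml; apply/andP; split; lra.
- rewrite (gtr0_norm h0) in h01 *.
  have lo : h * ln (z - 1) <= f (z + h) - f z by apply: f_slope_ge; lra.
  have hi : f (z + h) - f z <= h * ln z by apply: f_slope_le; lra.
  have k1 : h * ln (z - 2) <= h * ln (z - 1) by rewrite ler_pM2l//; lra.
  rewrite ler_norml; apply/andP; split; lra.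
- by rewrite h0 normr0 ltxx in h01.
Qed.

Let S (N : nat) x : R := \sum_(0 <= k < N) (x + k%:R)^-1.
Let L (N : nat) x : R := \sum_(0 <= k < N) ln (x + k%:R).

Let f_shift N x : 0 < x -> f (x + N%:R) = f x + L N x.
Proof.
move=> x0; elim: N => [|N IH]; first by rewrite /L big_nil !addr0.
by rewrite /L big_nat_recr//= -natr1 addrA f_step ?addn_gt0// IH addrA.
Qed.

Let is_derive_L N x : 0 < x -> is_derive x 1 (L N) (S N x).
Proof.
move=> x0; elim: N => [|N IH].
  rewrite /S /L big_nil.
  rewrite (_ : (fun x => _) = cst 0)//; first exact: is_derive_cst.
  by apply/funext => y; rewrite big_nil.
rewrite (_ : L N.+1 = fun y => L N y + ln (y + N%:R)); last first.
  by apply/funext => y; rewrite /L big_nat_recr.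
rewrite /S big_nat_recr//= -/(S N x) -[(x + N%:R)^-1]div1r.
apply: is_derive_add => //.
by apply: (is_derive_log (f := fun y => y + N%:R)); [exact: addn_gt0|exact: is_derive_addc].
Qed.

(** Transport the quotient from [x] to [x + N]: the difference is a finite sum of
differentiable logarithms, and at [x + N] the quotient is known up to
[ln (x + N) - ln (x + N - 2)], which is small. *)
Lemma is_derive_convex_solution x : 0 < x -> is_derive x 1 f (gauss_limit x).
Proof.
move=> x0; apply/is_derive_quotient/cvgrPdist_le => e e0.
have e30 : 0 < e / 3 by rewrite divr_gt0.
have [N [N2 Nln Nu]] : exists N : nat, [/\ 2 < x + N%:R,
    ln (x + N%:R) - ln (x + N%:R - 2) <= e / 3 &
    `|gauss_limit x - gauss_approx N x| <= e / 3].
  have /cvgrPdist_le /(_ _ e30) uP := gauss_approx_cvg x0.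
  near \oo => N; exists N.
  have N0 : 6 / e + 2 <= N%:R by near: N; exact: nbhs_infty_ger.
  have e60 : 0 < 6 / e by rewrite divr_gt0.
  have z0 : 0 < x + N%:R - 2 by lra.
  split; [lra| |by near: N].
  rewrite -ln_div ?posrE; [|lra..].
  have -> : (x + N%:R) / (x + N%:R - 2) = 1 + 2 / (x + N%:R - 2).
    by field; rewrite gt_eqF.
  apply: (@le_trans _ _ (2 / (x + N%:R - 2))).
    by apply: le_ln1Dx; rewrite (lt_trans (ltrN10 _))// divr_gt0.
  rewrite ler_pdivrMr// -ler_pdivrMl// invf_div; lra.
(* The difference quotients of f - g at x turn out to be at most e / 3. *)
pose g t := ln (x + N%:R) * t - L N t.
have /is_derive_quotient/cvgrPdist_le/(_ _ e30) dg :
    is_derive x 1 g (gauss_approx N x).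
  apply: is_derive_add; last by apply: is_derive_opp; exact: is_derive_L.
  apply: (is_derive_eq (is_derive_mul (is_derive_cst (ln (x + N%:R)) x 1) (is_derive_id x 1))).
  by rewrite mul0r add0r mulr1.
near=> h.
have h0 : h != 0 by near: h; exact: nbhs_dnbhs_neq.
have h1 : `|h| <= 1 by near: h; apply: dnbhs0_le.
have hx : `|h| < x by near: h; apply: dnbhs0_lt.
have nh : 0 < `|h| by rewrite normr_gt0.
have hx0 : 0 < h + x by move: hx; rewrite ltr_norml => /andP[? _]; lra.
have := @f_slope (x + N%:R) h N2; rewrite nh h1 => /(_ isT) sl.
have {}sl : `|h^-1 * (g (h + x) - g x) - h^-1 * (f (h + x) - f x)| <= e / 3.
  rewrite -mulrBr normrM normfV -ler_pdivlMl ?invr_gt0// invrK.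
  apply: le_trans (_ : `|h| * (ln (x + N%:R) - ln (x + N%:R - 2)) <= _); last first.
    by rewrite ler_pM2l.
  apply: le_trans sl; rewrite le_eqVlt; apply/orP; left; apply/eqP; congr (`| _ |).
  have := f_shift N hx0; have := f_shift N x0.
  rewrite (addrC h) addrAC /g => -> ->; ring.
have gh : `|gauss_approx N x - h^-1 * (g (h + x) - g x)| <= e / 3.
  by near: h; exact: dg.
move: sl gh Nu; rewrite !ler_norml => /andP[? ?] /andP[? ?] /andP[? ?].
by apply/andP; split; lra.
Unshelve. all: by end_near. Qed.

End ConvexSolution.

Section Digamma.
Context {R : realType}.
Implicit Types x : R.

(** [Gamma] is the exponential of the convex solution [ln Gamma]. *)
Lemma digammaE x : 0 < x -> digamma x = gauss_limit x.
Proof.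
move=> x0; have Gx := Gamma_gt0 x0.
have df : is_derive x 1 (fun y => ln (Gamma y)) (gauss_limit x).
  apply: is_derive_convex_solution => // [y y0|y z l y0 z0 l01].
    by rewrite GammaS// lnM ?posrE ?Gamma_gt0// addrC.
  exact: ln_Gamma_convex.
have dG : is_derive x 1 (@Gamma R) (gauss_limit x * Gamma x).
  apply: (@near_eq_is_derive _ _ _ (fun y => expR (ln (Gamma y)))).
    by near=> y; rewrite lnK// posrE Gamma_gt0//; near: y; exact: lt_nbhsr.
  by apply: (is_derive_eq (is_derive_exp df)); rewrite lnK ?posrE.
by rewrite /digamma derive1E (@derive_val _ _ _ _ _ _ _ dG) mulfK ?gt_eqF.
Unshelve. all: by end_near. Qed.

Lemma digammaS x : 0 < x -> digamma (x + 1) = digamma x + x^-1.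
Proof. by move=> x0; rewrite !digammaE ?addr_gt0// gauss_limitS. Qed.

Lemma digamma_le x : 0 < x -> digamma x <= ln x.
Proof. by move=> x0; rewrite digammaE// gauss_limit_le. Qed.

Lemma digamma_ge x : 0 < x -> ln x - x^-1 <= digamma x.
Proof. by move=> x0; rewrite digammaE// gauss_limit_ge. Qed.

Lemma digamma1 : digamma 1 = - euler_mascheroni R.
Proof. by rewrite digammaE// gauss_limit1. Qed.

Lemma continuous_digamma x : 0 < x -> {for x, continuous (@digamma R)}.
Proof.
move=> x0; have h := continuous_gauss_limit x0.
suff : digamma y @[y --> x] --> gauss_limit x by rewrite -digammaE.
apply: cvg_trans h; apply: near_eq_cvg.
by near=> y; rewrite digammaE//; near: y; exact: lt_nbhsr.
Unshelve. all: by end_near. Qed.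

End Digamma.

(** * Strict convexity *)

Section StrictConvexity.
Context {R : realType}.
Implicit Types (f g : R -> R) (a c x y t : R).

(** The first derivative is existential: only [g] enters the convexity criterion,
and sums of functions then compose without exhibiting it. *)
Definition has_deriv2 a f g := exists f1 : R -> R,
  forall x, a < x -> is_derive x 1 f (f1 x) /\ is_derive x 1 f1 (g x).

Lemma has_deriv2_add a f g f' g' : has_deriv2 a f f' -> has_deriv2 a g g' ->
  has_deriv2 a (fun x => f x + g x) (fun x => f' x + g' x).
Proof.
move=> [f1 df] [g1 dg]; exists (fun x => f1 x + g1 x) => x ax.
have [[? ?] [? ?]] := (df x ax, dg x ax).
by split; exact: is_derive_add.
Qed.

Lemma has_deriv2_opp a f f' : has_deriv2 a f f' ->
  has_deriv2 a (fun x => - f x) (fun x => - f' x).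
Proof.
move=> [f1 df]; exists (fun x => - f1 x) => x ax.
by have [? ?] := df x ax; split; exact: is_derive_opp.
Qed.

Let MVT_ray a f f1 x y : (forall x, a < x -> is_derive x 1 f (f1 x)) ->
  a < x -> x < y -> exists2 c, x < c < y & f y - f x = f1 c * (y - x).
Proof.
move=> df ax xy; have [||c] := @MVT R f f1 x y xy.
- by move=> z; rewrite in_itv/= => /andP[xz _]; apply: df; exact: lt_trans xz.
- apply: continuous_in_subspaceT => z; rewrite inE/= in_itv/= => /andP[xz _].
  apply/differentiable_continuous/derivable1_diffP.
  by case: (df z (lt_le_trans ax xz)).
- by rewrite in_itv/= => xcy e; exists c.
Qed.

Lemma strictly_convex_deriv2 a f g : has_deriv2 a f g ->
  (forall x, a < x -> 0 < g x) -> strictly_convex_on `]a, +oo[ f.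
Proof.
move=> [f1 df] g0; have {}f1_incr x y : a < x -> x < y -> f1 x < f1 y.
  move=> ax xy.
  have [c /andP[xc _] e] := @MVT_ray a f1 g x y (fun z az => (df z az).2) ax xy.
  by rewrite -subr_gt0 e mulr_gt0 ?subr_gt0// g0// (lt_trans ax).
have lt_case x y t : a < x -> x < y -> 0 < t < 1 ->
    f (t * x + (1 - t) * y) < t * f x + (1 - t) * f y.
  move=> ax xy /andP[t0 t1]; set z := t * x + (1 - t) * y.
  have t10 : 0 < 1 - t by rewrite subr_gt0.
  have yx0 : 0 < y - x by rewrite subr_gt0.
  have zx : z - x = (1 - t) * (y - x) by rewrite /z; ring.
  have yz : y - z = t * (y - x) by rewrite /z; ring.
  have xz : x < z by rewrite -subr_gt0 zx mulr_gt0.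
  have zy : z < y by rewrite -subr_gt0 yz mulr_gt0.
  have df1 w : a < w -> is_derive w 1 f (f1 w) by move=> /df[].
  have [c1 /andP[xc1 c1z] e1] := MVT_ray df1 ax xz.
  have [c2 /andP[zc2 _] e2] := MVT_ray df1 (lt_trans ax xz) zy.
  have c12 : f1 c1 < f1 c2.
    by apply: f1_incr; [exact: lt_trans xc1|exact: lt_trans zc2].
  rewrite -subr_gt0.
  have -> : t * f x + (1 - t) * f y - f z =
      (1 - t) * (f y - f z) - t * (f z - f x) by ring.
  rewrite e1 e2 zx yz.
  have -> : (1 - t) * (f1 c2 * (t * (y - x))) - t * (f1 c1 * ((1 - t) * (y - x))) =
      t * (1 - t) * (y - x) * (f1 c2 - f1 c1) by ring.
  by rewrite !mulr_gt0 ?subr_gt0.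
move=> x y t; rewrite /= !in_itv/= !andbT => ax ay xy t01.
have [xy'|yx|e] := ltgtP x y; [exact: lt_case| |by rewrite e eqxx in xy].
have /andP[t0 t1] := t01.
have := @lt_case y x (1 - t) ay yx; rewrite subr_gt0 t1 ltrBlDr ltrDl t0 => /(_ isT).
rewrite (_ : 1 - (1 - t) = t); last by ring.
by rewrite addrC [X in _ < X -> _]addrC.
Qed.

(** A function with a limit at infinity is the sum of the translates of
[f x - f (x + 1)], up to a constant, so strict convexity can be tested there. *)
Lemma strictly_convex_telescope a f (l : R) :
  strictly_convex_on `]a, +oo[ (fun x => f x - f (x + 1)) ->
  f x @[x --> +oo] --> l -> strictly_convex_on `]a, +oo[ f.
Proof.
move=> df fl x y t; rewrite /= !in_itv/= !andbT => ax ay xy t01.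
set z := t * x + (1 - t) * y.
(* The convexity defect of f along the translates by n: it decreases to 0. *)
pose e (n : nat) := t * f (x + n%:R) + (1 - t) * f (y + n%:R) - f (z + n%:R).
have e_decr n : e n.+1 < e n.
  have := df (x + n%:R) (y + n%:R) t; rewrite /= !in_itv/= !andbT.
  rewrite (lt_le_trans ax) ?lerDl// (lt_le_trans ay) ?lerDl//.
  rewrite (inj_eq (addIr _)) xy => /(_ isT isT isT t01).
  have -> : t * (x + n%:R) + (1 - t) * (y + n%:R) = z + n%:R by rewrite /z; ring.
  by rewrite /e -natr1 !addrA; lra.
have e_cvg : e n @[n --> \oo] --> (0 : R).
  have fn w : f (w + n%:R) @[n --> \oo] --> l.
    apply: (cvg_comp _ _ _ fl); apply/cvgryPge => M; near=> n.
    by rewrite -lerBlDl; near: n; exact: nbhs_infty_ger.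
  rewrite (_ : 0 = t * l + (1 - t) * l - l); last by ring.
  by apply: cvgB => //; apply: cvgD; apply: cvgMr.
have e1 : 0 <= e 1.
  rewrite -(cvg_lim _ e_cvg)//; apply: nonincreasing_cvgn_ge; last exact/cvgP/e_cvg.
  by apply/nonincreasing_seqP => n; exact: ltW.
have := le_lt_trans e1 (e_decr 0); rewrite /e !addr0; lra.
Unshelve. all: by end_near. Qed.

(** The increments of a convex function along an arithmetic progression
increase; if the function has a limit they tend to zero, so they are negative. *)
Lemma strictly_convex_decreasing a f (l : R) : strictly_convex_on `]a, +oo[ f ->
  f x @[x --> +oo] --> l -> strictly_decreasing_on `]a, +oo[ f.
Proof.
move=> cf fl y x; rewrite !inE/= !in_itv/= !andbT => ay ax xy.
pose p (n : nat) := x + (y - x) * n%:R.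
have yx0 : 0 < y - x by rewrite subr_gt0.
have ap n : a < p n by rewrite (lt_le_trans ax)// lerDl mulr_ge0// ltW.
pose e (n : nat) := f (p n.+1) - f (p n).
have e_incr n : e n < e n.+1.
  have := cf (p n) (p n.+2) 2^-1; rewrite /= !in_itv/= !andbT.
  have -> : 2^-1 * p n + (1 - 2^-1) * p n.+2 = p n.+1.
    by rewrite /p -!natr1; field.
  have pn : p n != p n.+2.
    by rewrite lt_eqF// /p ltrD2l ltr_pM2l// ltr_nat.
  by move=> /(_ (ap n) (ap n.+2) pn); rewrite /e => h; have := h ltac:(lra); lra.
have fp : f (p n) @[n --> \oo] --> l.
  apply: (cvg_comp _ _ _ fl); apply/cvgryPge => M; near=> n.
  rewrite -lerBlDl -ler_pdivrMl//.
  by near: n; exact: nbhs_infty_ger.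
have e_cvg : e n @[n --> \oo] --> (0 : R).
  rewrite -(subrr l); apply: cvgB => //.
  by rewrite (cvg_shiftS (fun n => f (p n))).
have e1 : e 1 <= 0.
  rewrite -(cvg_lim _ e_cvg)//; apply: nondecreasing_cvgn_le; last exact/cvgP/e_cvg.
  by apply/nondecreasing_seqP => n; exact: ltW.
have := lt_le_trans (e_incr 0) e1.
by rewrite /e /p mulr0 addr0 mulr1 subrKC; lra.
Unshelve. all: by end_near. Qed.

Lemma strictly_concaveN (A : set R) f :
  strictly_convex_on A (fun x => - f x) -> strictly_concave_on A f.
Proof. by move=> cf x y t Ax Ay xy t01; have := cf x y t Ax Ay xy t01; lra. Qed.

Lemma strictly_convex_add (A : set R) f g : strictly_convex_on A f ->
  strictly_convex_on A g -> strictly_convex_on A (fun x => f x + g x).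
Proof.
move=> cf cg x y t Ax Ay xy t01.
by have := cf x y t Ax Ay xy t01; have := cg x y t Ax Ay xy t01; lra.
Qed.

Lemma strictly_convex_shift a c f : strictly_convex_on `]a + c, +oo[ f ->
  strictly_convex_on `]a, +oo[ (fun x => f (x + c)).
Proof.
move=> cf x y t; rewrite /= !in_itv/= !andbT => ax ay xy t01.
have -> : t * x + (1 - t) * y + c = t * (x + c) + (1 - t) * (y + c) by ring.
apply: cf => //; rewrite /= ?in_itv/= ?andbT ?ltrD2r//.
by rewrite (inj_eq (addIr _)).
Qed.

Lemma strictly_convex_eq a f g : (forall x, a < x -> f x = g x) ->
  strictly_convex_on `]a, +oo[ f -> strictly_convex_on `]a, +oo[ g.
Proof.
move=> fg cf x y t ax ay xy t01; have := cf x y t ax ay xy t01.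
move: ax ay; rewrite /= !in_itv/= !andbT => ax ay.
have /andP[t0 t1] := t01.
rewrite !fg//.
have -> : a = t * a + (1 - t) * a by ring.
by rewrite ltrD// ltr_pM2l// subr_gt0.
Qed.

End StrictConvexity.

(** * The limits of phi *)

Section Limits.
Context {R : realType}.
Implicit Types x c : R.

Lemma cvg_inv_pinfty : (x : R)^-1 @[x --> +oo] --> (0 : R).
Proof.
apply/gtr0_cvgV0; last exact: cvg_id.
by near=> x; near: x; exact: nbhs_pinfty_gt.
Unshelve. all: by end_near. Qed.

Lemma cvg_ln_addB c : ln (x + c) - ln x @[x --> +oo] --> (0 : R).
Proof.
have h : 1 + c * x^-1 @[x --> +oo] --> (1 : R).
  rewrite -[X in _ --> X]addr0 -[X in _ --> _ + X](mulr0 c).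
  by apply: cvgD; [exact: cvg_cst|apply: cvgMr; exact: cvg_inv_pinfty].
have : ln (1 + c * x^-1) @[x --> +oo] --> (0 : R).
  by rewrite -ln1; apply: continuous_cvg h; exact: continuous_ln.
apply: cvg_trans; apply: near_eq_cvg; near=> x.
have x0 : 0 < x by near: x; exact: nbhs_pinfty_gt.
have xc : 0 < x + c.
  by rewrite -ltrBlDr sub0r; near: x; apply: nbhs_pinfty_gt; exact: num_real.
rewrite -ln_div ?posrE//; congr ln; field.
by rewrite gt_eqF.
Unshelve. all: by end_near. Qed.

Lemma cvg_digammaB_ln : digamma x - ln x @[x --> +oo] --> (0 : R).
Proof.
apply: (@squeeze_cvgr _ _ _ _ (fun x : R => - x^-1) (fun=> 0)).
- near=> x; have x0 : 0 < x by near: x; exact: nbhs_pinfty_gt.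
  by have := digamma_le x0; have := digamma_ge x0; lra.
- by rewrite -oppr0; apply: cvgN; exact: cvg_inv_pinfty.
- exact: cvg_cst.
Unshelve. all: by end_near. Qed.

Variable theta : R.
Hypothesis theta_gt0 : 0 < theta.

(** With [s = theta / x], the bounds [s <= expR s - 1 <= s / (1 - s)] trap the
function between [ln theta] and [ln theta - ln (1 - s)]. *)
Lemma cvg_ln_expm1_pinfty :
  ln (expR (theta / x) - 1) + ln x @[x --> +oo] --> ln theta.
Proof.
apply: (@squeeze_cvgr _ _ _ _ (fun=> ln theta)
  (fun x => ln theta - (ln (x - theta) - ln x))).
- near=> x; have x0 : 0 < x by near: x; exact: nbhs_pinfty_gt.
  have xt : 0 < x - theta.
    by rewrite subr_gt0; near: x; apply: nbhs_pinfty_gt; exact: num_real.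
  have w0 : 0 < theta / x by rewrite divr_gt0.
  have E0 : 0 < expR (theta / x) - 1 by rewrite subr_gt0 expR_gt1.
  have lo : theta / x <= expR (theta / x) - 1.
    by rewrite lerBrDl expR_ge1Dx.
  have hi : expR (theta / x) - 1 <= theta / (x - theta).
    have : expR (theta / x) <= (1 - theta / x)^-1.
      rewrite -[expR _]invrK -expRN lef_pV2 ?posrE ?expR_gt0 ?expR_ge1Dx//.
      by rewrite subr_gt0 ltr_pdivrMr// mul1r -subr_gt0.
    have -> : theta / (x - theta) = (1 - theta / x)^-1 - 1.
      by field; rewrite !gt_eqF.
    lra.
  have {}lo : ln (theta / x) <= ln (expR (theta / x) - 1) by rewrite ler_ln ?posrE.
  have {}hi : ln (expR (theta / x) - 1) <= ln (theta / (x - theta)).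
    by rewrite ler_ln ?posrE// divr_gt0.
  move: lo hi; rewrite !ln_div ?posrE//; lra.
- exact: cvg_cst.
- rewrite -[X in _ --> X]subr0; apply: cvgB; first exact: cvg_cst.
  exact: cvg_ln_addB.
Unshelve. all: by end_near. Qed.

Lemma phi_cvg_pinfty : phi theta x @[x --> +oo] --> ln theta.
Proof.
rewrite (_ : phi theta = fun x => (digamma x - ln x) +
    (ln (expR (theta / x) - 1) + ln x)); last first.
  by apply/funext => x; rewrite /phi; ring.
rewrite -[X in _ --> X]add0r.
by apply: cvgD; [exact: cvg_digammaB_ln|exact: cvg_ln_expm1_pinfty].
Qed.

Lemma cvg_inv_right0 : (x : R)^-1 @[x --> 0^'+] --> +oo.
Proof.
apply/cvgrVy; first by near=> x.
by apply: cvg_at_right_filter; exact: cvg_id.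
Unshelve. all: by end_near. Qed.

(** The singularity at [0] is isolated in the last term, so that the sign of
[theta - 1] decides the limit. *)
Lemma phi_split x : 0 < x -> phi theta x =
  digamma (x + 1) + ln (1 - expR (- (theta / x))) + (theta - 1) / x.
Proof.
move=> x0; have w0 : 0 < theta / x by rewrite divr_gt0.
rewrite /phi digammaS//.
have -> : expR (theta / x) - 1 = expR (theta / x) * (1 - expR (- (theta / x))).
  by rewrite mulrBr mulr1 expRxMexpNx_1.
rewrite lnM ?posrE ?expR_gt0//; last first.
  by rewrite subr_gt0 expR_lt1 oppr_lt0.
rewrite expRK; ring.
Qed.

Lemma phi_regular_cvg0 :
  digamma (x + 1) + ln (1 - expR (- (theta / x))) @[x --> 0^'+]
    --> - euler_mascheroni R.
Proof.
rewrite -[X in _ --> X]addr0; apply: cvgD.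
  rewrite -digamma1 -[X in _ --> digamma X]add0r.
  apply: (@continuous_cvg _ _ _ _ _ (fun x => x + 1) (@digamma R)).
    by rewrite add0r; exact: continuous_digamma.
  apply: cvg_at_right_filter.
  by apply: cvgD; [exact: cvg_id|exact: cvg_cst].
rewrite -[X in _ --> X]ln1; apply: continuous_cvg; first exact: continuous_ln.
rewrite -[X in _ --> X]subr0; apply: cvgB; first exact: cvg_cst.
apply: (@cvg_comp _ _ _ (fun x : R => theta / x) (fun y => expR (- y))
    _ (pinfty_nbhs R)); last exact: cvgr_expR.
by apply: gt0_cvgMry => //; exact: cvg_inv_right0.
Unshelve. all: by end_near. Qed.

Lemma phi_cvg0_eq1 : theta = 1 -> phi theta x @[x --> 0^'+] --> - euler_mascheroni R.
Proof.
move=> t1; have := phi_regular_cvg0; apply: cvg_trans; apply: near_eq_cvg.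
by near=> x; rewrite phi_split// t1 subrr mul0r addr0.
Unshelve. all: by end_near. Qed.

Lemma phi_cvg0_gt1 : 1 < theta -> phi theta x @[x --> 0^'+] --> +oo.
Proof.
move=> t1; apply/cvgryPge => M; near=> x.
have h : - euler_mascheroni R - 1 < digamma (x + 1) + ln (1 - expR (- (theta / x))).
  by near: x; apply: (cvgr_gt _ phi_regular_cvg0); rewrite ltrBlDr ltrDl.
rewrite phi_split//.
have : M + euler_mascheroni R + 1 <= (theta - 1) / x.
  rewrite -ler_pdivrMl ?subr_gt0//.
  by near: x; apply: ((cvgryPge _).1 cvg_inv_right0).
lra.
Unshelve. all: by end_near. Qed.

Lemma phi_cvg0_lt1 : theta < 1 -> phi theta x @[x --> 0^'+] --> -oo.
Proof.
move=> t1; apply/cvgrNyPle => M; near=> x.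
have h : digamma (x + 1) + ln (1 - expR (- (theta / x))) < - euler_mascheroni R + 1.
  by near: x; apply: (cvgr_lt _ phi_regular_cvg0); rewrite ltrDl.
rewrite phi_split//.
have : - M - euler_mascheroni R + 1 <= (1 - theta) / x.
  rewrite -ler_pdivrMl ?subr_gt0//.
  by near: x; apply: ((cvgryPge _).1 cvg_inv_right0).
lra.
Unshelve. all: by end_near. Qed.

End Limits.

(** * The second derivative of ln (e^(theta/x) - 1) *)

Section LogExpm1.
Context {R : realType}.
Implicit Types w x : R.

(** [x ^+ 2] times the second derivative of [ln (expR (theta / x) - 1)], which
depends on [w = theta / x] only. *)
Definition expm1_curvature w : R :=
  (2 * w * expR w * (expR w - 1) - w ^+ 2 * expR w) / (expR w - 1) ^+ 2.

(** As a polynomial in [v = expR w - 1] the difference factors as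
[(v - w) * (w - (1 - w) * v)], and both factors are nonnegative by
[1 + s <= expR s] at [s = w] and [s = - w]. *)
Lemma expm1_curvature_ge w : 0 < w -> 1 + w <= expm1_curvature w.
Proof.
move=> w0; rewrite /expm1_curvature.
have v0 : w <= expR w - 1 by rewrite lerBrDl expR_ge1Dx.
have E1 : (1 - w) * expR w <= 1.
  rewrite -[leRHS](expRxMexpNx_1 w) [leRHS]mulrC ler_wpM2r ?expR_ge0//.
  exact: expR_ge1Dx.
move: v0 E1; set E := expR w => v0 E1.
rewrite ler_pdivlMr ?exprn_gt0//; last lra.
rewrite -subr_ge0.
have -> : 2 * w * E * (E - 1) - w ^+ 2 * E - (1 + w) * (E - 1) ^+ 2 =
  (E - 1 - w) * (1 - (1 - w) * E) by ring.
by rewrite mulr_ge0 ?subr_ge0.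
Qed.

(** The difference is a quadratic polynomial in [expR w - 1] with zero
discriminant: it is a perfect square. *)
Lemma expm1_curvature_le_sqr w : 0 < w -> expm1_curvature w <= (1 + w / 2) ^+ 2.
Proof.
move=> w0; rewrite /expm1_curvature.
have v0 : 0 < expR w - 1 by rewrite subr_gt0 expR_gt1.
move: v0; set E := expR w => v0.
rewrite ler_pdivrMr ?exprn_gt0// -subr_ge0.
have -> : (1 + w / 2) ^+ 2 * (E - 1) ^+ 2 - (2 * w * E * (E - 1) - w ^+ 2 * E) =
  ((1 - w / 2) * (E - 1) - w) ^+ 2 by field.
exact: sqr_ge0.
Qed.

Lemma expm1_curvature_le_double w : 2 <= w -> expm1_curvature w <= 2 * w.
Proof.
move=> w2; rewrite /expm1_curvature; have w0 : 0 < w by lra.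
have v0 : 0 < expR w - 1 by rewrite subr_gt0 expR_gt1.
move: v0; set E := expR w => v0.
rewrite ler_pdivrMr ?exprn_gt0// -subr_ge0.
have -> : 2 * w * (E - 1) ^+ 2 - (2 * w * E * (E - 1) - w ^+ 2 * E) =
  w * (w - 2) * (E - 1) + w ^+ 2 by ring.
by rewrite addr_ge0 ?sqr_ge0// !mulr_ge0// ?subr_ge0//; lra.
Qed.

Lemma has_deriv2_ln_expm1 (theta : R) : 0 < theta ->
  has_deriv2 0 (fun x => ln (expR (theta / x) - 1))
    (fun x => expm1_curvature (theta / x) / x ^+ 2).
Proof.
move=> t0; have dw x : 0 < x -> is_derive x 1 (fun y => theta / y) (- theta / x ^+ 2).
  move=> x0; have xn0 : x != 0 by rewrite gt_eqF.
  apply: (is_derive_eq (is_derive_mul (is_derive_cst theta x 1)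
    (is_derive_inv xn0 (is_derive_id x 1)))).
  by rewrite /=; field.
have dE x : 0 < x -> is_derive x 1 (fun y => expR (theta / y) - 1)
    (- theta / x ^+ 2 * expR (theta / x)).
  move=> x0; have D := is_derive_add (is_derive_exp (dw x x0))
    (is_derive_cst (-1 : R) x 1).
  apply: (is_derive_eq D).
  by rewrite addr0.
have E0 x : 0 < x -> 0 < expR (theta / x) - 1.
  by move=> x0; rewrite subr_gt0 expR_gt1 divr_gt0.
exists (fun x => - theta / x ^+ 2 * expR (theta / x) / (expR (theta / x) - 1)) => x x0.
have xn0 : x != 0 by rewrite gt_eqF.
have En0 : expR (theta / x) - 1 != 0 by rewrite gt_eqF// E0.
split; first 
  exact: (is_derive_log (f := fun y => expR (theta / y) - 1) (E0 x x0) (dE x x0)).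
have x2n0 : x ^+ 2 != 0 by rewrite expf_neq0.
have dx2 : is_derive x 1 (fun y : R => y ^+ 2) (2 * x).
  apply: (is_derive_eq (is_derive_mul (is_derive_id x 1) (is_derive_id x 1))).
  by rewrite mul1r mulr1 -mulr2n mulr_natl.
apply: (is_derive_eq (is_derive_mul (is_derive_mul
  (is_derive_mul (is_derive_cst (- theta) x 1)
    (is_derive_inv (f := fun y => y ^+ 2) x2n0 dx2))
  (is_derive_exp (dw x x0)))
  (is_derive_inv (f := fun y => expR (theta / y) - 1) En0 (dE x x0)))).
rewrite /expm1_curvature /=; move: En0; set E := expR _ => En0.
by field; rewrite En0 xn0.
Qed.

End LogExpm1.

(** The elementary functions compared with [digamma] are sums of these, apart
from [ln (expR (theta / x) - 1)]. *)
Section LogRational.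
Context {R : realType}.
Implicit Types a b d c x : R.

Definition log_rational a b d c x : R :=
  a * ln (x + c) + b * (x + c)^-1 + d * (x + c) ^- 2.

Lemma has_deriv2_log_rational m a b d c : 0 <= m + c ->
  has_deriv2 m (log_rational a b d c)
    (fun x => - a * (x + c) ^- 2 + 2 * b * (x + c) ^- 3 + 6 * d * (x + c) ^- 4).
Proof.
move=> mc0; have xc0 x : m < x -> 0 < x + c.
  by move=> mx; rewrite (le_lt_trans mc0)// ltrD2r.
have dV n x : m < x -> is_derive x 1 (fun y : R => (y + c) ^- n)
    (- n%:R * (x + c) ^- n.+1).
  move=> /xc0/lt0r_neq0 xc; elim: n => [|n IH].
    rewrite oppr0 mul0r (_ : (fun y => _) = cst 1); first exact: is_derive_cst.
    by apply/funext => y; rewrite expr0 invr1.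
  rewrite (_ : (fun y => _) = fun y => (y + c) ^- n * (y + c)^-1); last first.
    by apply/funext => y; rewrite exprSr invfM mulrC.
  apply: (is_derive_eq (is_derive_mul IH
    (is_derive_inv (f := fun y => y + c) xc (is_derive_addc c x)))).
  by rewrite !exprS -natr1; field; rewrite ?expf_neq0 ?xc.
have dC (k : R) (f : R -> R) (f1 : R) x : is_derive x 1 f f1 ->
    is_derive x 1 (fun y : R => k * f y) (k * f1).
  move=> df; apply: (is_derive_eq (is_derive_mul (is_derive_cst k x 1) df)).
  by rewrite mul0r add0r.
exists (fun x => a * (x + c) ^- 1 + b * (- 1%:R * (x + c) ^- 2) +
    d * (- 2%:R * (x + c) ^- 3)) => x mx.
split.
  apply: is_derive_add; last by apply: dC; exact: (dV 2).
  apply: is_derive_add; last by apply: dC; exact: (dV 1).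
  apply: dC; apply: (is_derive_eq
    (is_derive_log (f := fun y => y + c) (xc0 x mx) (is_derive_addc c x))).
  by rewrite mul1r.
have D := is_derive_add (is_derive_add (dC a _ _ _ (dV 1 x mx))
  (dC b _ _ _ (dC (- 1%:R) _ _ _ (dV 2 x mx))))
  (dC d _ _ _ (dC (- 2%:R) _ _ _ (dV 3 x mx))).
by apply: (is_derive_eq D); ring.
Qed.

End LogRational.

(** * Convexity and concavity of phi *)

Section PhiConvexity.
Context {R : realType}.
Implicit Types x y : R.

(** [corr] is minus the beginning of the expansion of the digamma function, with
[1 / 24] in place of [1 / 12]. Its second derivative [(y^-1 * (1 + y^-1 / 2))^2]
is then exactly the upper bound of [expm1_curvature_le_sqr] at [theta = 1], divided
by [y ^+ 2]. *)
Let corr y : R := - ln y + 2^-1 * y^-1 + 24^-1 * y ^- 2.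

Lemma strictly_convex_digamma_sub_ln :
  strictly_convex_on `]1, +oo[ (fun y => digamma y - ln (y - 2^-1) : R).
Proof.
apply: (@strictly_convex_telescope _ _ _ 0).
- apply: (@strictly_convex_eq _ 1 (fun y => log_rational 0 (-1) 0 0 y +
      log_rational (-1) 0 0 (- 2^-1) y + log_rational 1 0 0 2^-1 y)).
    move=> y y1; have y0 : 0 < y by rewrite (lt_trans ltr01).
    rewrite /log_rational digammaS// !mul0r !addr0.
    rewrite (_ : y + 1 - 2^-1 = y + 2^-1); [ring|by field].
  apply: strictly_convex_deriv2.
    apply: has_deriv2_add; last by apply: has_deriv2_log_rational; lra.
    by apply: has_deriv2_add; apply: has_deriv2_log_rational; lra.
  move=> y y1; rewrite /=.
  have [y0 ym yp] : [/\ 0 < y, 0 < 2 * y - 1 & 0 < 2 * y + 1] by split; lra.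
  set d := (X in 0 < X).
  have -> : d = (16 * y ^+ 2 - 2) / (y ^+ 3 * (2 * y - 1) ^+ 2 * (2 * y + 1) ^+ 2).
    by rewrite /d; field; rewrite !gt_eqF//; lra.
  rewrite divr_gt0 ?mulr_gt0 ?exprn_gt0//.
  by nra.
- rewrite (_ : (fun y => _) = fun y => (digamma y - ln y) - (ln (y + - 2^-1) - ln y)).
    rewrite -[X in _ --> X]subr0.
    by apply: cvgB; [exact: cvg_digammaB_ln|exact: cvg_ln_addB].
  by apply/funext => y; ring.
Qed.

Lemma strictly_convex_digamma_corr :
  strictly_convex_on `]1, +oo[ (fun y => - (digamma y + corr y)).
Proof.
apply: (@strictly_convex_telescope _ _ _ 0).
- apply: (@strictly_convex_eq _ 1 (fun y =>
      log_rational 1 2^-1 (- 24^-1) 0 y + log_rational (-1) 2^-1 24^-1 1 y)).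
    move=> y y1; have y0 : 0 < y by rewrite (lt_trans ltr01).
    rewrite /log_rational /corr digammaS// !addr0; field.
    by rewrite !gt_eqF//; lra.
  apply: strictly_convex_deriv2.
    by apply: has_deriv2_add; apply: has_deriv2_log_rational; lra.
  move=> y y1; rewrite /=.
  have [y0 yp] : 0 < y /\ 0 < y + 1 by split; lra.
  set d := (X in 0 < X).
  have -> : d = (y ^+ 3 + 3 / 2 * y ^+ 2 - 4^-1) / (y ^+ 4 * (y + 1) ^+ 4).
    by rewrite /d; field; rewrite !gt_eqF.
  rewrite divr_gt0 ?mulr_gt0 ?exprn_gt0//.
  have y3 : 1 < y ^+ 3 by rewrite exprn_egt1.
  have y2 : 1 < y ^+ 2 by rewrite exprn_egt1.
  lra.
- have c2 : (x : R) ^- 2 @[x --> +oo] --> (0 : R).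
    rewrite (_ : (fun x => _) = fun x : R => x^-1 * x^-1).
      by rewrite -[X in _ --> X](mulr0 0); apply: cvgM; exact: cvg_inv_pinfty.
    by apply/funext => x; rewrite expr2 invfM.
  rewrite (_ : (fun y => _) = fun y =>
      - ((digamma y - ln y) + (2^-1 * y^-1 + 24^-1 * y ^- 2))).
    rewrite -[X in _ --> X]oppr0; apply: cvgN.
    rewrite -[X in _ --> X]addr0; apply: cvgD; first exact: cvg_digammaB_ln.
    rewrite -[X in _ --> X]addr0 -[X in _ --> X + _](mulr0 2^-1).
    rewrite -[X in _ --> _ + X](mulr0 24^-1).
    by apply: cvgD; apply: cvgMr => //; exact: cvg_inv_pinfty.
  by apply/funext => y; rewrite /corr; ring.
Qed.

Variable theta : R.
Hypothesis theta_gt0 : 0 < theta.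

Lemma phi_strictly_convex : 2 <= theta -> strictly_convex_on `]0, +oo[ (phi theta).
Proof.
move=> t2.
apply: (@strictly_convex_eq _ 0 (fun x => (digamma (x + 1) - ln (x + 1 - 2^-1)) +
  (ln (expR (theta / x) - 1) + log_rational 0 (-1) 0 0 x + log_rational 1 0 0 2^-1 x))).
  move=> x x0; rewrite /log_rational /phi digammaS// !mul0r !addr0.
  rewrite (_ : x + 1 - 2^-1 = x + 2^-1); [ring|by field].
apply: strictly_convex_add.
  apply: (@strictly_convex_shift _ 0 1 (fun y => digamma y - ln (y - 2^-1))).
  by rewrite add0r; exact: strictly_convex_digamma_sub_ln.
apply: strictly_convex_deriv2.
  apply: has_deriv2_add; last by apply: has_deriv2_log_rational; lra.
  by apply: has_deriv2_add;
    [exact: has_deriv2_ln_expm1|apply: has_deriv2_log_rational; lra].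
move=> x x0; rewrite /=.
have w0 : 0 < theta / x by rewrite divr_gt0.
have J : 1 + 2 / x <= expm1_curvature (theta / x).
  by apply: le_trans (expm1_curvature_ge w0); rewrite lerD2l ler_pM2r ?invr_gt0.
apply: (@lt_le_trans _ _ (x ^- 2 - (x + 2^-1) ^- 2)).
  rewrite subr_gt0 ltf_pV2 ?posrE ?exprn_gt0//; last lra.
  by rewrite ltr_pXn2r ?nnegrE//; lra.
have : (1 + 2 / x) / x ^+ 2 <= expm1_curvature (theta / x) / x ^+ 2.
  by rewrite ler_pM2r// invr_gt0 exprn_gt0.
have -> : (1 + 2 / x) / x ^+ 2 = x ^- 2 + 2 * x ^- 3 by field; rewrite gt_eqF.
rewrite !addr0; lra.
Qed.

Lemma phi_strictly_concave : theta <= 1 -> strictly_concave_on `]0, +oo[ (phi theta).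
Proof.
move=> t1; apply: strictly_concaveN.
apply: (@strictly_convex_eq _ 0 (fun x => - (digamma (x + 1) + corr (x + 1)) +
  (- ln (expR (theta / x) - 1) + log_rational 0 1 0 0 x +
   log_rational (-1) 2^-1 24^-1 1 x))).
  by move=> x x0; rewrite /log_rational /corr /phi digammaS// !addr0; ring.
apply: strictly_convex_add.
  apply: (@strictly_convex_shift _ 0 1 (fun y => - (digamma y + corr y))).
  by rewrite add0r; exact: strictly_convex_digamma_corr.
apply: strictly_convex_deriv2.
  apply: has_deriv2_add; last by apply: has_deriv2_log_rational; lra.
  apply: has_deriv2_add; last by apply: has_deriv2_log_rational; lra.
  by apply: has_deriv2_opp; exact: has_deriv2_ln_expm1.
move=> x x0; rewrite /= !addr0.
have x10 : 0 < x + 1 by lra.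
have w0 : 0 < theta / x by rewrite divr_gt0.
have wx : theta / x <= x^-1 by rewrite -[leRHS]mul1r ler_pM2r ?invr_gt0.
pose s := (x + 1) ^- 2 + (x + 1) ^- 3 + 4^-1 * (x + 1) ^- 4.
have s0 : 0 < s by rewrite !addr_gt0 ?mulr_gt0 ?invr_gt0 ?exprn_gt0.
have x2s0 : 0 < x ^+ 2 * s by rewrite mulr_gt0 ?exprn_gt0.
suff J : expm1_curvature (theta / x) < 2 * x^-1 + x ^+ 2 * s.
  set d := (X in 0 < X).
  have -> : d = (2 * x^-1 + x ^+ 2 * s - expm1_curvature (theta / x)) / x ^+ 2.
    by rewrite /d /s; field; rewrite !gt_eqF.
  by rewrite divr_gt0 ?exprn_gt0// subr_gt0.
(* theta / x <= 1 / x, so the linear bound is absorbed by 2 / x. *)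
have [w2|w2] := leP 2 (theta / x).
  by apply: (le_lt_trans (expm1_curvature_le_double w2)); lra.
apply: (le_lt_trans (expm1_curvature_le_sqr w0)).
(* For x < 1/2 the square is below 4, while 2 / x alone exceeds 4. *)
have [x2|x2] := ltP x 2^-1.
  have x4 : 2 < x^-1 by rewrite -[ltLHS]invrK ltf_pV2 ?posrE ?invr_gt0.
  have : (1 + theta / x / 2) ^+ 2 < 2 ^+ 2 by rewrite ltr_pXn2r ?nnegrE//; lra.
  lra.
apply: (@le_lt_trans _ _ ((1 + x^-1 / 2) ^+ 2)).
  by rewrite ler_pXn2r ?nnegrE//; have := invr_gt0 x; rewrite x0; lra.
rewrite -subr_gt0.
have -> : 2 * x^-1 + x ^+ 2 * s - (1 + x^-1 / 2) ^+ 2 =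
    (x ^+ 3 + 3 / 2 * x ^+ 2 - 4^-1) / (x ^+ 2 * (x + 1) ^+ 4).
  by rewrite /s; field; rewrite !gt_eqF.
rewrite divr_gt0 ?mulr_gt0 ?exprn_gt0//.
have : (2^-1) ^+ 2 <= x ^+ 2 by rewrite ler_pXn2r ?nnegrE//; lra.
have : (0 : R) < x ^+ 3 by rewrite exprn_gt0.
lra.
Qed.

End PhiConvexity.

Unset Implicit Arguments.
Set Strict Implicit.

Theorem theorem2 (R : realType) (theta : R) (theta_gt0 : 0 < theta) :
  [/\ (strictly_increasing_on `]0, +oo[ (phi theta) <-> 0 < theta <= 1) /\
      (2 <= theta -> strictly_decreasing_on `]0, +oo[ (phi theta)),
      (0 < theta <= 1 -> strictly_concave_on `]0, +oo[ (phi theta)) /\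
      (2 <= theta -> strictly_convex_on `]0, +oo[ (phi theta))
    & (phi theta x @[x --> +oo] --> ln theta) /\
      [/\ theta = 1 -> phi theta x @[x --> 0^'+] --> - euler_mascheroni R,
          1 < theta -> phi theta x @[x --> 0^'+] --> +oo
        & 0 < theta < 1 -> phi theta x @[x --> 0^'+] --> -oo]].
Proof.
have concave : 0 < theta <= 1 -> strictly_concave_on `]0, +oo[ (phi theta).
  by move=> /andP[_]; exact: phi_strictly_concave.
have convex := phi_strictly_convex theta_gt0.
have limy := phi_cvg_pinfty theta_gt0.
split; [split; [split=> [incr|t1]|move=> t2]|by []|split=> //].
- rewrite theta_gt0 leNgt; apply/negP => t1.
  near (0 : R)^'+ => x.
  have x0 : 0 < x by near: x; exact: nbhs_right_gt.
  have x1 : x < 1 by near: x; exact: nbhs_right_lt.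
  have : phi theta 1 <= phi theta x.
    by near: x; apply: ((cvgryPge _).1 (phi_cvg0_gt1 theta_gt0 t1)).
  by rewrite leNgt incr// inE/= in_itv/= ?andbT.
- have decr : strictly_decreasing_on `]0, +oo[ (fun x => - phi theta x).
    apply: (@strictly_convex_decreasing _ 0 _ (- ln theta)); last exact: cvgN.
    by move=> x y t x0 y0 xy t01; have := concave t1 x y t x0 y0 xy t01; lra.
  by move=> x y x0 y0 xy; rewrite -ltrN2; exact: decr.
- exact: strictly_convex_decreasing (convex t2) limy.
- split; [exact: phi_cvg0_eq1|exact: phi_cvg0_gt1|].
  by move=> /andP[_]; exact: phi_cvg0_lt1.
Unshelve. all: by end_near. Qed.
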